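(* Let $0<\mu\le L$, let $f\in\mathcal{S}^1_{\mu,L}(\mathbb{R}^d)$ and $g\in\mathcal{F}^0(\mathbb{R}^d)$, put $\Phi=f+g$ with minimizer $x^\star$, let $s\in(0,1/L]$, let $\alpha>0$ be real and let $r$ be a real number with $r>2\alpha$. Then there exists a positive integer $K$ (written $K(\alpha,r)$) such that, for every initial point $x_0=y_0\in\mathbb{R}^d$, the sequence $\{x_k\}_{k\ge 0}$ generated by M-FISTA-$\alpha$ satisfies $$\Phi(x_k)-\Phi(x^\star)\le \frac{\mathcal{E}(K)}{s\,k^\alpha\left(k^\alpha+r k^{\alpha-1}\right)},\qquad \forall k\ge K.$$ Furthermore, if $s=1/L$, the sequence satisfies $$\Phi(x_k)-\Phi(x^\star)\le \frac{L\,\mathcal{E}(K)}{k^\alpha\left(k^\alpha+r k^{\alpha-1}\right)},\qquad \forall k\ge K.$$ Here $\mathcal{E}$ is the Lyapunov function of M-FISTA-$\alpha$ defined in the context.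
   Context: $\|\cdot\|$ and $\langle\cdot,\cdot\rangle$ are the Euclidean norm and inner product on $\mathbb{R}^d$. $\mathcal{F}^0(\mathbb{R}^d)$ is the class of continuous convex functions $g:\mathbb{R}^d\to\mathbb{R}$. For $0<\mu\le L$, $\mathcal{S}^1_{\mu,L}(\mathbb{R}^d)$ is the class of continuously differentiable convex functions $f:\mathbb{R}^d\to\mathbb{R}$ such that $\|\nabla f(x)-\nabla f(y)\|\le L\|x-y\|$ and $f(y)\ge f(x)+\langle\nabla f(x),y-x\rangle+\frac{\mu}{2}\|y-x\|^2$ for all $x,y\in\mathbb{R}^d$. $x^\star$ denotes the unique global minimizer of $\Phi=f+g$. The $s$-proximal value is $$P_s(x)=\mathop{\arg\min}_{y\in\mathbb{R}^d}\left\{\frac{1}{2s}\left\|y-(x-s\nabla f(x))\right\|^2+g(y)\right\},\qquad x\in\mathbb{R}^d.$$ M-FISTA-$\alpha$ with step size $s>0$ and parameters $\alpha,r$: starting from $x_0=y_0$, for $k\ge1$, $$z_{k-1}=P_s(y_{k-1}),$$ $$x_k=z_{k-1}\ \text{ if } \Phi(z_{k-1})\le \Phi(x_{k-1}),\qquad x_k=x_{k-1}\ \text{ if } \Phi(z_{k-1})>\Phi(x_{k-1}),$$ $$y_k=x_k+\frac{(k-1)^\alpha}{k^\alpha+rk^{\alpha-1}}(x_k-x_{k-1})+\frac{(k-1)^\alpha+r(k-1)^{\alpha-1}}{k^\alpha+rk^{\alpha-1}}(z_{k-1}-x_k).$$ For $k=1$ the last term is taken to be $0$ (in that step $x_1=z_0$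 when $s\in(0,1/L]$). Lyapunov function, for positive integers $k$ for which the expression is defined (that is, $k\ge2$ if $\alpha<1$): $$\mathcal{E}(k)=s k^\alpha(k^\alpha+rk^{\alpha-1})\left(\Phi(x_k)-\Phi(x^\star)\right)+\frac12\left\|\left[k^\alpha+r\left(k^{\alpha-1}-(k-1)^{\alpha-1}\right)\right](y_k-x_k)+r(k-1)^{\alpha-1}(y_k-x^\star)\right\|^2.$$ *)

(* Defs.v *)
From HB Require Import structures.
From mathcomp Require Import all_boot all_order all_algebra.
From mathcomp Require Import all_classical all_reals all_analysis.

Set Implicit Arguments.
Unset Strict Implicit.
Unset Printing Implicit Defensive.

Import Order.TTheory GRing.Theory Num.Theory.
Import numFieldNormedType.Exports.

Local Open Scope classical_set_scope.
Local Open Scope ring_scope.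

Section Euclidean.
Context {R : realType} {d : nat}.
Implicit Types (u v x : 'rV[R]_d) (f g h : 'rV[R]_d -> R).

Definition dotv u v : R := \sum_i u 0 i * v 0 i.

(* The norm `|x| of the library on 'rV[R]_d is the sup norm; it induces the
   same topology and the same notion of differentiability. *)
Definition enorm u : R := Num.sqrt (dotv u u).

(* The row of partial derivatives; meaningful where f is differentiable. *)
Definition gradient f x : 'rV[R]_d := \row_i 'D_(delta_mx 0 i) f x.

Definition F0 g : Prop :=
  continuous g /\ @convex_function R 'rV[R]_d [set: 'rV[R]_d] g.

Definition S1 (mu L : R) f : Prop :=
  [/\ forall x, differentiable f x,
      continuous (gradient f),
      @convex_function R 'rV[R]_d [set: 'rV[R]_d] f,
      forall x y,
        enorm (gradient f x - gradient f y) <= L * enorm (x - y)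
    & forall x y,
        f x + dotv (gradient f x) (y - x) + mu / 2 * enorm (y - x) ^+ 2 <= f y].

Definition argmin h : set 'rV[R]_d := [set x | forall y, h x <= h y].

(* For g in F0 and 0 < s the argmin is a singleton, so the default value 0
   is never used. *)
Definition prox_value f g (s : R) x : 'rV[R]_d :=
  xget 0 (argmin (fun y =>
    (2 * s)^-1 * enorm (y - (x - s *: gradient f x)) ^+ 2 + g y)).

End Euclidean.

Section MFISTA.
Context {R : realType} {d : nat}.
Variables (f g : 'rV[R]_d -> R) (s alpha r : R).

Let Phi (x : 'rV[R]_d) : R := f x + g x.

Definition kweight (k : nat) : R :=
  k%:R `^ alpha + r * k%:R `^ (alpha - 1).

(* In powR, 0 `^ a is 0 for a != 0 and 1 for a = 0.  For k = 1 this gives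
   (k - 1)^alpha = 0 in the momentum term, while (k - 1)^(alpha - 1) in the
   correction term has no meaning when alpha < 1, hence the case distinction. *)
Definition mfista (x0 : 'rV[R]_d) (x y z : nat -> 'rV[R]_d) : Prop :=
  [/\ x 0%N = x0, y 0%N = x0
    & forall k : nat, (0 < k)%N ->
      [/\ z k.-1 = prox_value f g s (y k.-1),
          x k = (if Phi (z k.-1) <= Phi (x k.-1) then z k.-1 else x k.-1)
        & y k = x k
            + (k.-1%:R `^ alpha / kweight k) *: (x k - x k.-1)
            + (if k == 1%N then 0
               else (kweight k.-1 / kweight k) *: (z k.-1 - x k))]].

(* At k = 1 this is to be used only for 1 <= alpha, because of
   (k - 1)^(alpha - 1). *)
Definition lyapunov (xstar : 'rV[R]_d) (x y : nat -> 'rV[R]_d) (k : nat) : R :=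
  s * k%:R `^ alpha * kweight k * (Phi (x k) - Phi xstar)
  + 2^-1 * enorm
      ((k%:R `^ alpha
        + r * (k%:R `^ (alpha - 1) - k.-1%:R `^ (alpha - 1))) *: (y k - x k)
       + (r * k.-1%:R `^ (alpha - 1)) *: (y k - xstar)) ^+ 2.

End MFISTA.

(* Main.v *)
Require Import Defs.
From mathcomp Require Import all_boot all_order all_algebra.
From mathcomp Require Import all_classical all_reals all_analysis.
From mathcomp Require Import ring lra.

Import Order.TTheory GRing.Theory Num.Theory.
Import numFieldNormedType.Exports.

Local Open Scope classical_set_scope.
Local Open Scope ring_scope.

(** Write A_k = k^alpha, B_k = r k^(alpha-1) and w_k = A_k + B_k, so that
    E(k) = s A_k w_k (Phi(x_k) - Phi(xstar)) + |V_k|^2 / 2. The momentum and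
    correction terms of the algorithm are chosen so that the vector V_k has two
    expressions (lyapunov_vector, momentum_vector):
      V_k = w_k (y_k - x_k) + B_(k-1) (x_k - xstar),
      V_(k+1) = A_k (z_k - x_k) + B_k (z_k - xstar).
    The bound follows once E(k+1) <= E(k) for all k >= K, with K independent of
    the starting point: then s A_k w_k (Phi(x_k) - Phi(xstar)) <= E(k) <= E(K).

    One step of E is controlled by the proximal gradient inequality
    (proximal_step), which compares Phi(z_k) with Phi at any point x. Adding
    A_k times the inequality at x_k and B_k times the one at xstar, and completing
    the square, V_(k+1) - V_k enters only through
      V_(k+1) - V_k = w_k (z_k - y_k) + D_k,
      D_k = (B_k - B_(k-1)) (x_k - xstar).
    If D_k vanished, as it does for alpha = 1, the sum would telescope as soon as
    A_(k+1) w_(k+1) <= w_k^2, which holds for large k because r > 2 alpha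
    (sqr_weight_growth). In general D_k leaves an error quadratic in y_k - x_k
    and x_k - xstar, of size |B_k - B_(k-1)| w_k. Strong convexity provides
    the negative term
      - (s mu / 2) w_k (A_k |x_k - y_k|^2 + B_k |xstar - y_k|^2),
    and it absorbs the error (drift_absorbed) because
    |B_k - B_(k-1)| / B_k tends to 0 (powR_consecutive_close).

    The remaining inputs are the descent lemma for f, and the existence of
    the proximal point. The latter comes from compactness: the minimizer xstar
    of Phi yields an affine minorant of g (minimizer_subgradient), hence the
    proximal objective is coercive. *)

(** * Euclidean inner product *)

Lemma dotvC (R : realType) (d : nat) (u v : 'rV[R]_d) : dotv u v = dotv v u.
Proof. by apply: eq_bigr => i _; rewrite mulrC. Qed.

Lemma dotvDl (R : realType) (d : nat) (u u' v : 'rV[R]_d) :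
  dotv (u + u') v = dotv u v + dotv u' v.
Proof. by rewrite -big_split; apply: eq_bigr => i _; rewrite mxE mulrDl. Qed.

Lemma dotvZl (R : realType) (d : nat) (a : R) (u v : 'rV[R]_d) :
  dotv (a *: u) v = a * dotv u v.
Proof. by rewrite mulr_sumr; apply: eq_bigr => i _; rewrite mxE mulrA. Qed.

Lemma dotvNl (R : realType) (d : nat) (u v : 'rV[R]_d) :
  dotv (- u) v = - dotv u v.
Proof. by rewrite -scaleN1r dotvZl mulN1r. Qed.

Lemma dotvDr (R : realType) (d : nat) (u v v' : 'rV[R]_d) :
  dotv u (v + v') = dotv u v + dotv u v'.
Proof. by rewrite dotvC dotvDl ![dotv _ u]dotvC. Qed.

Lemma dotvZr (R : realType) (d : nat) (a : R) (u v : 'rV[R]_d) :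
  dotv u (a *: v) = a * dotv u v.
Proof. by rewrite dotvC dotvZl dotvC. Qed.

Lemma dotvNr (R : realType) (d : nat) (u v : 'rV[R]_d) :
  dotv u (- v) = - dotv u v.
Proof. by rewrite dotvC dotvNl dotvC. Qed.

Definition dotvE := (dotvDl, dotvDr, dotvZl, dotvZr, dotvNl, dotvNr).

Lemma dotv_ge0 (R : realType) (d : nat) (u : 'rV[R]_d) : 0 <= dotv u u.
Proof. by apply: sumr_ge0 => i _; rewrite -expr2 sqr_ge0. Qed.

Lemma enorm_sqr (R : realType) (d : nat) (u : 'rV[R]_d) :
  enorm u ^+ 2 = dotv u u.
Proof. by rewrite /enorm sqr_sqrtr ?dotv_ge0. Qed.

(** Young's inequality; it stands in for Cauchy-Schwarz, since only bounds with
    a prescribed weight c are ever needed. *)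
Lemma dotv_young (R : realType) (d : nat) (c : R) (u v : 'rV[R]_d) :
  0 < c -> 2 * dotv u v <= c^-1 * dotv u u + c * dotv v v.
Proof.
move=> c0; have := dotv_ge0 _ _ (u - c *: v).
rewrite !dotvE (dotvC _ _ v u) => h.
rewrite -(ler_pM2l c0) [leRHS]mulrDr mulVKf ?gt_eqF//.
lra.
Qed.

(** * Consequences of convexity and smoothness *)

Lemma ler_of_le_add_harmonic (R : realType) (a b c : R) :
  (forall n : nat, a <= b + c / n.+1%:R) -> a <= b.
Proof.
move=> h.
suff hb : (fun n => b + c * harmonic n) @ \oo --> b.
  by apply: (cvgr_to_ge hb); apply: nearW => n; exact: h.
rewrite -[X in _ --> X]addr0 -(mulr0 c).
by apply: cvgD; [exact: cvg_cst | apply: cvgMr; exact: cvg_harmonic].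
Qed.

(** Convexity gives f(u) - f(w) <= <G(u), u - w>. Applied along the segment from
    x to x + v cut into n + 1 equal pieces, and with the Lipschitz bound on G at
    each node, this is a Riemann sum that exceeds the integral of
    t |-> L t |v|^2 by L |v|^2 / (2 (n + 1)); then n tends to infinity. *)
Lemma descent_lemma (R : realType) (d : nat) (L : R) (f : 'rV[R]_d -> R)
    (G : 'rV[R]_d -> 'rV[R]_d) :
  0 < L ->
  (forall x y : 'rV[R]_d, f x + dotv (G x) (y - x) <= f y) ->
  (forall x y, dotv (G x - G y) (G x - G y) <= L ^+ 2 * dotv (x - y) (x - y)) ->
  forall x v : 'rV[R]_d, f (x + v) <= f x + dotv (G x) v + L / 2 * dotv v v.
Proof.
move=> L0 fc GL x v.
(* Young with weight L t turns the Lipschitz bound into a bound on the slope. *)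
have slope t : 0 < t ->
    dotv (G (x + t *: v)) v <= dotv (G x) v + L * t * dotv v v.
  move=> t0; have Lt0 : 0 < L * t by rewrite mulr_gt0.
  have := GL (x + t *: v) x.
  have -> : x + t *: v - x = t *: v by rewrite addrC addKr.
  have := dotv_young _ _ _ (G (x + t *: v) - G x) v Lt0.
  set q := G _ - G _.
  have -> : G (x + t *: v) = q + G x by rewrite subrK.
  clearbody q; rewrite !dotvE => h1 h2.
  have h3 : (L * t)^-1 * dotv q q <= L * t * dotv v v.
    rewrite [leLHS]mulrC ler_pdivrMr//; apply: le_trans h2 _.
    by rewrite le_eqVlt; apply/orP; left; apply/eqP; ring.
  lra.
apply: (ler_of_le_add_harmonic _ _ _ (L * dotv v v / 2)) => n.
set h : R := n.+1%:R^-1.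
have h0 : 0 < h by rewrite invr_gt0 ltr0n.
(* i (i + 1) / 2 is the sum of the first i nodes, each contributing L h^2. *)
have part i : f (x + (i%:R * h) *: v)
    <= f x + i%:R * h * dotv (G x) v
       + L * dotv v v * (h ^+ 2 * (i%:R * (i%:R + 1) / 2)).
  elim: i => [|i IH].
    by rewrite !mul0r scale0r !addr0 mulr0 mulr0 addr0.
  have ih0 : 0 < i.+1%:R * h by rewrite mulr_gt0 ?ltr0n.
  have := slope _ ih0.
  have := fc (x + (i.+1%:R * h) *: v) (x + (i%:R * h) *: v).
  have -> : x + (i%:R * h) *: v - (x + (i.+1%:R * h) *: v) = - h *: v.
    by rewrite opprD addrACA subrr add0r -scalerBl -[i.+1%:R]natr1; congr (_ *: _); ring.
  rewrite dotvZr => h1 h2.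
  have h3 := ler_wpM2l (ltW h0) h2.
  move: IH h1 h3; rewrite -[i.+1%:R]natr1.
  lra.
have := part n.+1; rewrite mulfV ?pnatr_eq0// scale1r mul1r.
move=> /le_trans; apply.
have -> : h ^+ 2 * (n.+1%:R * (n.+1%:R + 1) / 2) = (1 + h) / 2.
  by rewrite /h; field; rewrite nat1r pnatr_eq0.
by rewrite -/h; lra.
Qed.

Lemma convex_function_segment (R : realType) (d : nat) (g : 'rV[R]_d -> R) :
  @convex_function R 'rV[R]_d [set: 'rV[R]_d] g ->
  forall (x y : 'rV[R]_d) (t : R), 0 <= t -> t <= 1 ->
    g (x + t *: (y - x)) <= g x + t * (g y - g x).
Proof.
move=> gc x y t t0 t1.
have t01 : Itv.spec (@Itv.num_sem R) (Itv.Real `[0%Z, 1%Z]) t.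
  by apply/and3P; split; rewrite ?realE ?t0//= ?bnd_simp.
have := gc (Itv.mk t01) y x.
rewrite !inE => /(_ Logic.I Logic.I).
rewrite convRE /= /unstable.onem => h.
have -> : x + t *: (y - x) = t *: y + (1 - t) *: x.
  by apply/rowP => i; rewrite !mxE; ring.
apply: le_trans h _; lra.
Qed.

(** First-order optimality for a sum whose first part q has a quadratic upper
    model at z with slope p: moving from z by t (y - z), the minimality of z and
    the convexity of g leave <p, y - z> + g(y) - g(z) >= - t C |y - z|^2, and t
    tends to 0. It serves twice: with q = f at xstar, and with q the proximal
    quadratic at the proximal point. *)
Lemma minimizer_subgradient (R : realType) (d : nat)
    (q g : 'rV[R]_d -> R) (z p : 'rV[R]_d) (C : R) :
  @convex_function R 'rV[R]_d [set: 'rV[R]_d] g ->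
  (forall v, q (z + v) <= q z + dotv p v + C * dotv v v) ->
  argmin (fun y => q y + g y) z ->
  forall y, g z - dotv p (y - z) <= g y.
Proof.
move=> gc qz zmin y.
apply: (ler_of_le_add_harmonic _ _ _ (C * dotv (y - z) (y - z))) => n.
set t : R := n.+1%:R^-1.
have t0 : 0 < t by rewrite invr_gt0 ltr0n.
have t1 : t <= 1 by rewrite invf_le1 ?ltr0n// ler1n.
have := zmin (z + t *: (y - z)).
have := convex_function_segment _ _ _ gc z y t (ltW t0) t1.
have := qz (t *: (y - z)).
rewrite !(dotvZl, dotvZr) => h1 h2 h3.
rewrite -(ler_pM2l t0) -/t; lra.
Qed.

(** * The proximal point *)

Lemma continuous_sqr_dist (R : realType) (d : nat) (c : 'rV[R]_d) :
  continuous (fun y : 'rV[R]_d => dotv (y - c) (y - c)).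
Proof.
move=> y; rewrite /dotv.
have coord (i : 'I_d) : (fun w : 'rV[R]_d => (w - c) 0 i) @ y --> (y - c) 0 i.
  have -> : (fun w : 'rV[R]_d => (w - c) 0 i) = (fun w => w 0 i - c 0 i).
    by apply/funext => w; rewrite !mxE.
  by rewrite !mxE; exact: (cvgB (@coord_continuous R 1 d 0 i y) (cvg_cst (c 0 i))).
apply: (@cvg_big _ _ +%R 0 xpredT _ _ _ _
  (fun i (w : 'rV[R]_d) => (w - c) 0 i * (w - c) 0 i)
  (fun i => (y - c) 0 i * (y - c) 0 i) (nbhs_filter y)) => [|i _].
  exact: add_continuous.
by apply: cvgM; exact: coord.
Qed.

(** Completing the square in the quadratic plus the affine minorant of g confines
    the sublevel set of x0 to a ball around x0, of radius M below; this ball lies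
    in a compact box, where the continuous objective attains its minimum. *)
Lemma proximal_argmin_exists (R : realType) (d : nat) (kappa : R)
    (g : 'rV[R]_d -> R) (c p x0 : 'rV[R]_d) :
  0 < kappa -> continuous g ->
  (forall y : 'rV[R]_d, g x0 + dotv p (y - x0) <= g y) ->
  argmin (fun y => kappa * enorm (y - c) ^+ 2 + g y) !=set0.
Proof.
move=> k0 gc gp.
set h := fun y => _.
pose q := (x0 - c) + (2 * kappa)^-1 *: p.
pose M := 2 * enorm q.
have M0 : 0 <= M by rewrite mulr_ge0// sqrtr_ge0.
pose box := [set y : 'rV[R]_d |
  forall i, `[x0 0 i - M, x0 0 i + M]%classic (y 0 i)].
have x0box : box x0.
  by move=> i /=; rewrite in_itv/=; apply/andP; split; lra.
have sub y : h y <= h x0 -> box y.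
  rewrite /h !enorm_sqr.
  have -> : y - c = (y - x0) + (x0 - c) by rewrite addrA subrK.
  have := gp y; set u := y - x0; set w := x0 - c => gpy hy i.
  (* q is such that 2 kappa <u, q> collects all linear terms in u = y - x0. *)
  have pE : p = (2 * kappa) *: (q - w).
    by rewrite /q addrAC subrr add0r scalerA mulfV ?scale1r// mulf_neq0 ?gt_eqF.
  have uq : dotv u u <= 2 * dotv (- q) u.
    move: hy gpy; rewrite pE; clearbody u w q.
    rewrite !dotvE (dotvC _ _ w u) (dotvC _ _ q u) => hy gpy.
    by rewrite -(ler_pM2l k0); lra.
  have uM : dotv u u <= M ^+ 2.
    have h2 : 0 < 2^-1 :> R by rewrite invr_gt0.
    rewrite /M exprMn enorm_sqr.
    have := dotv_young _ _ _ (- q) u h2; rewrite invrK dotvNl dotvNr dotvNl.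
    rewrite dotvNl in uq; lra.
  have ui : `|u 0 i| <= M.
    rewrite -(ler_pXn2r (ltn0Sn 1)) ?nnegrE ?normr_ge0// real_normK ?num_real//.
    apply: le_trans uM; rewrite /dotv (bigD1 i)//= -expr2 lerDl.
    by apply: sumr_ge0 => j _; rewrite -expr2 sqr_ge0.
  move: ui; rewrite /u !mxE ler_norml /= in_itv /= => /andP[? ?].
  by apply/andP; split; lra.
have cbox : compact box.
  apply: (@rV_compact _ _ (fun i => `[x0 0 i - M, x0 0 i + M]%classic)) => i.
  exact: segment_compact.
have ch : {within box, continuous h}.
  have -> : h = (fun y => kappa * dotv (y - c) (y - c) + g y).
    by apply/funext => y; rewrite /h enorm_sqr.
  apply: continuous_subspaceT => y.
  exact: (cvgD (cvgM (cvg_cst kappa) (continuous_sqr_dist _ _ c y)) (gc y)).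
have [z zbox zmin] := EVT_min_rV (ex_intro _ x0 x0box) cbox ch.
exists z => y; have [/sub ybox|hlt] := leP (h y) (h x0).
  by apply: zmin; rewrite inE.
by apply: le_trans (ltW hlt); apply: zmin; rewrite inE.
Qed.

(** The proximal gradient inequality, multiplied by 2 s. It adds three bounds:
    descent from y to z, strong convexity of f between y and x, and the
    subgradient inequality of g at z, where the subgradient is
    (y - z) / s - grad f(y). The condition s L <= 1 absorbs the quadratic term
    of the descent lemma into |y - z|^2. *)
Lemma proximal_step (R : realType) (d : nat) (mu L s : R)
    (f g : 'rV[R]_d -> R) (xstar : 'rV[R]_d) :
  0 < mu -> mu <= L -> S1 mu L f -> F0 g ->
  argmin (fun x => f x + g x) xstar ->
  0 < s -> s <= 1 / L ->
  forall y x z, z = prox_value f g s y ->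
    2 * s * (f z + g z) <= 2 * s * (f x + g x) + 2 * dotv (y - z) (z - x)
      + dotv (y - z) (y - z) - s * mu * dotv (x - y) (x - y).
Proof.
move=> mu0 muL [_ _ _ lip strong] [gcont gconv] xmin s0 sL y x z zE.
have L0 : 0 < L by exact: lt_le_trans muL.
have sL1 : s * L <= 1 by move: sL; rewrite ler_pdivlMr.
have desc := descent_lemma _ _ L f (gradient f) L0.
have {}desc : forall x v : 'rV[R]_d,
    f (x + v) <= f x + dotv (gradient f x) v + L / 2 * dotv v v.
  apply: desc => u v.
    apply: le_trans (strong u v); rewrite lerDl.
    by rewrite mulr_ge0 ?sqr_ge0// divr_ge0// ltW.
  rewrite -!enorm_sqr -exprMn ler_pXn2r ?nnegrE//.
  - exact: sqrtr_ge0.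
  - by rewrite mulr_ge0 ?sqrtr_ge0// ltW.
have minorant u : g xstar + dotv (- gradient f xstar) (u - xstar) <= g u.
  rewrite dotvNl.
  exact: minimizer_subgradient gconv (desc xstar) xmin u.
pose kappa := (2 * s)^-1.
have k0 : 0 < kappa by rewrite invr_gt0 mulr_gt0.
have ks : kappa * (2 * s) = 1 by rewrite mulVf// mulf_neq0 ?gt_eqF.
pose c := y - s *: gradient f y.
have zmin := xgetPex 0 (proximal_argmin_exists _ _ kappa g c _ _ k0 gcont minorant).
rewrite -[xget _ _]/(prox_value f g s y) -zE in zmin.
pose p := (2 * kappa) *: (z - c).
have quad v : kappa * enorm (z + v - c) ^+ 2
    <= kappa * enorm (z - c) ^+ 2 + dotv p v + kappa * dotv v v.
  rewrite !enorm_sqr /p addrAC; set q := z - c; clearbody q.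
  by rewrite !dotvE (dotvC _ _ v q); lra.
have gz := minimizer_subgradient _ _ _ g _ _ _ gconv quad zmin x.
have fz := desc y (z - y); rewrite addrC subrK in fz.
have fx := strong y x; rewrite enorm_sqr in fx.
have pE : 2 * s * dotv p (x - z)
    = 2 * dotv (z - y) (x - z) + 2 * s * dotv (gradient f y) (x - z).
  rewrite /p /c opprB addrCA dotvZl !mulrA.
  have -> : 2 * s * 2 * kappa = 2 * (kappa * (2 * s)) by ring.
  rewrite ks mulr1.
  by rewrite [dotv (_ *: _ + _) _]dotvDl dotvZl; ring.
have zyE : dotv (z - y) (x - z) = dotv (y - z) (z - x).
  by rewrite -opprB dotvNl -[x - z]opprB dotvNr opprK.
have gE : dotv (gradient f y) (x - z)
    = dotv (gradient f y) (x - y) - dotv (gradient f y) (z - y).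
  by rewrite !dotvE; ring.
have nE : dotv (z - y) (z - y) = dotv (y - z) (y - z).
  by rewrite -opprB dotvNl dotvNr opprK.
have hsL : s * L * dotv (y - z) (y - z) <= dotv (y - z) (y - z).
  by rewrite ler_piMl// dotv_ge0.
rewrite nE in fz; rewrite zyE gE in pE.
have s20 : 0 < 2 * s by rewrite mulr_gt0.
have {}gz := ler_wpM2l (ltW s20) gz.
have {}fz := ler_wpM2l (ltW s20) fz.
have {}fx := ler_wpM2l (ltW s20) fx.
rewrite mulrBr pE in gz.
lra.
Qed.

(** * One step of the Lyapunov function *)

(** The left side is |V + w|^2 - |V|^2 for V = (A + B) u + B' e and the drift
    w = (B - B') e. Every term of it is at most eps B (A + B) times a
    combination of |u|^2 and |e|^2, and |e|^2 <= 2 |u|^2 + 2 |u + e|^2; the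
    constants add up to at most 10. *)
Lemma drift_absorbed (R : realType) (d : nat) (c eps A B B' : R)
    (u e : 'rV[R]_d) :
  0 < B -> B <= A -> 0 <= B' -> eps <= 1 -> 10 * eps <= c ->
  `|B - B'| <= eps * B ->
  2 * ((B - B') * (A + B)) * dotv u e + (B - B') * (B' + B) * dotv e e
    <= c * (A + B) * (A * dotv u u + B * dotv (u + e) (u + e)).
Proof.
move=> B0 BA B'0 eps1 epsc; set D := B - B' => hD.
have dB : `|D| <= B by apply: le_trans hD _; rewrite ler_piMl// ltW.
have B'2 : B' <= 2 * B by move: dB; rewrite /D ler_norml => /andP[]; lra.
have A0 : 0 <= A by lra.
have w0 : 0 < A + B by lra.
have eB0 : 0 <= eps * B by exact: le_trans hD.
have ue : `|2 * dotv u e| <= dotv u u + dotv e e.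
  have h1 := dotv_ge0 _ _ (u + e); have h2 := dotv_ge0 _ _ (u - e).
  move: h1 h2; rewrite !dotvE (dotvC _ _ e u) ler_norml => h1 h2.
  by apply/andP; split; lra.
(* The difference of the two sides is |2 u + e|^2. *)
have ee : dotv e e <= 2 * dotv u u + 2 * dotv (u + e) (u + e).
  have := dotv_ge0 _ _ (2 *: u + e).
  by rewrite !dotvE (dotvC _ _ e u); lra.
have uu0 := dotv_ge0 _ _ u; have ee0 := dotv_ge0 _ _ e.
have S0 := dotv_ge0 _ _ (u + e).
move: (dotv u u) (dotv e e) (dotv u e) (dotv (u + e) (u + e)) ue ee uu0 ee0 S0.
move=> uu ee ue S hue hee uu0 ee0 S0.
have h1 : 2 * (D * (A + B)) * ue <= eps * B * (A + B) * (uu + ee).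
  apply: le_trans (ler_norm _) _.
  have -> : 2 * (D * (A + B)) * ue = D * (A + B) * (2 * ue) by ring.
  rewrite normrM ler_pM// normrM (gtr0_norm w0).
  by rewrite ler_wpM2r// ltW.
have h2 : D * (B' + B) * ee <= eps * B * (A + B) * (3 * ee).
  have -> : eps * B * (A + B) * (3 * ee) = eps * B * (3 * (A + B)) * ee by ring.
  rewrite ler_wpM2r//; apply: le_trans (ler_norm _) _.
  by rewrite normrM ler_pM// ger0_norm; lra.
have X0 : 0 <= eps * B * (A + B) by rewrite mulr_ge0// ltW.
have h3 : eps * B * (A + B) * (uu + 4 * ee)
    <= eps * B * (A + B) * (10 * (uu + S)) by rewrite ler_wpM2l//; lra.
have h4 : 10 * eps * (B * (A + B) * (uu + S)) <= c * (B * (A + B) * (uu + S)).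
  by rewrite ler_wpM2r ?mulr_ge0 ?addr_ge0 ?(ltW B0)//.
have h5 : c * (A + B) * (B * uu) <= c * (A + B) * (A * uu).
  have c0 : 0 <= c.
    by apply: le_trans epsc; rewrite mulr_ge0// -(pmulr_lge0 _ B0).
  by rewrite ler_wpM2l ?ler_wpM2r// mulr_ge0// ltW.
lra.
Qed.

(** With V and V' the vectors on the two sides and D = (B - B') (x - p), one has
    (A + B) (z - y) = V' - V - D. Hence
    2 (A + B) <y - z, V'> + (A + B)^2 |y - z|^2 = |V + D|^2 - |V'|^2, which is
    what (A + B) times the A, B combination of the two proximal inequalities
    produces; drift_absorbed then removes D. *)
Lemma energy_step (R : realType) (d : nat) (s mu eps A B B' W phi phiz phi' : R)
    (x y z p : 'rV[R]_d) :
  0 < s -> 0 < B -> B <= A -> 0 <= B' ->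
  eps <= 1 -> 10 * eps <= s * mu -> `|B - B'| <= eps * B ->
  W <= (A + B) ^+ 2 -> 0 <= phi' -> phi' <= phiz ->
  2 * s * phiz <= 2 * s * phi + 2 * dotv (y - z) (z - x)
    + dotv (y - z) (y - z) - s * mu * dotv (x - y) (x - y) ->
  2 * s * phiz <= 2 * dotv (y - z) (z - p)
    + dotv (y - z) (y - z) - s * mu * dotv (p - y) (p - y) ->
  s * W * phi' + 2^-1 * enorm (A *: (z - x) + B *: (z - p)) ^+ 2
    <= s * A * (A + B) * phi
       + 2^-1 * enorm ((A + B) *: (y - x) + B' *: (x - p)) ^+ 2.
Proof.
move=> s0 B0 BA B'0 eps1 epsc hD hW phi0 phiz' hx hp.
rewrite !enorm_sqr.
have := drift_absorbed _ _ (s * mu) eps A B B' (y - x) (x - p)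
  B0 BA B'0 eps1 epsc hD.
have yxE : x - y = - (y - x) by rewrite opprB.
have pyE : p - y = - ((y - x) + (x - p)) by rewrite addrA subrK opprB.
have zxE : z - x = (z - y) + (y - x) by rewrite addrA subrK.
have zpE : z - p = (z - y) + (y - x) + (x - p) by rewrite !addrA !subrK.
have yzE : y - z = - (z - y) by rewrite opprB.
(* All vectors are combinations of u = y - x, v = z - y and e = x - p. *)
rewrite {}yxE {}pyE {}zxE {}zpE {}yzE in hx hp *.
move: (y - x) (z - y) (x - p) hx hp => u v e.
rewrite !dotvE (dotvC _ _ u v) (dotvC _ _ e v) (dotvC _ _ e u) => hx hp hd.
have w0 : 0 < A + B by lra.
have A0 : 0 <= A by lra.
have hx' := ler_wpM2l (mulr_ge0 (ltW w0) A0) hx.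
have hp' := ler_wpM2l (mulr_ge0 (ltW w0) (ltW B0)) hp.
have hW' : s * (W * phi') <= s * ((A + B) ^+ 2 * phiz).
  rewrite ler_wpM2l//; first exact: ltW.
  apply: le_trans (ler_wpM2r phi0 hW) _.
  by rewrite ler_wpM2l// sqr_ge0.
lra.
Qed.

(** * Asymptotics of the weights *)

(** With t = 1 / k, division by k^(2 alpha) reduces the claim to
    (1 + t)^(2 alpha) (1 + r / (k + 1)) <= (1 + r t)^2. Here
    (1 + t)^(2 alpha) <= exp(2 alpha t) <= 1 / (1 - 2 alpha t) as soon as
    2 alpha t < 1, and this is at most 1 + r t exactly when
    2 alpha r t <= r - 2 alpha, which the lower bound on k expresses. *)
Lemma sqr_weight_growth (R : realType) (alpha r : R) (k : nat) :
  0 < alpha -> 2 * alpha < r -> (0 < k)%N ->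
  2 * alpha * r / (r - 2 * alpha) <= k%:R ->
  k.+1%:R `^ alpha * kweight alpha r k.+1 <= kweight alpha r k ^+ 2.
Proof.
move=> a0 ra k0 hk.
have r0 : 0 < r by lra.
have wE j : (0 < j)%N -> kweight alpha r j = j%:R `^ alpha * (1 + r / j%:R).
  move=> j0; rewrite /kweight powRB ?pnatr_eq0 -?lt0n ?j0 ?implybT//.
  by rewrite powRr1// mulrDr mulr1 mulrCA.
rewrite !wE//; set t : R := k%:R^-1.
have t0 : 0 < t by rewrite invr_gt0 ltr0n.
have q2 : (1 + t) `^ alpha * (1 + t) `^ alpha * (1 - 2 * alpha * t) <= 1.
  have e1 : (1 + t) `^ alpha <= expR (alpha * t).
    rewrite /powR gt_eqF; last lra.
    rewrite ler_expR ler_pM2l// le_ln1Dx//; lra.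
  have e2 : (1 + t) `^ alpha * (1 + t) `^ alpha <= expR (2 * alpha * t).
    have -> : 2 * alpha * t = alpha * t + alpha * t by ring.
    by rewrite expRD ler_pM// powR_ge0.
  have [h|h] := leP 0 (1 - 2 * alpha * t); last first.
    apply: (@le_trans _ _ 0); last exact: ler01.
    by rewrite mulr_ge0_le0 ?mulr_ge0 ?powR_ge0// ltW.
  have := expR_ge1Dx (- (2 * alpha * t)) => e3.
  have e4 : expR (2 * alpha * t) * expR (- (2 * alpha * t)) = 1.
    by rewrite -expRD subrr expR0.
  by rewrite -[leRHS]e4 ler_pM// mulr_ge0// powR_ge0.
have tk : 2 * alpha * r * t <= r - 2 * alpha.
  move: hk; rewrite ler_pdivrMr ?subr_gt0// => hk.
  by rewrite ler_pdivrMr ?ltr0n// [leRHS]mulrC.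
have q2r : (1 + t) `^ alpha * (1 + t) `^ alpha <= 1 + r * t.
  have pos : 0 < 1 - 2 * alpha * t.
    rewrite -(pmulr_rgt0 _ r0); lra.
  rewrite -(ler_pM2r pos); apply: le_trans q2 _.
  have := ler_wpM2r (ltW t0) tk; lra.
have P1 : k.+1%:R `^ alpha = k%:R `^ alpha * (1 + t) `^ alpha.
  rewrite -powRM ?addr_ge0 ?(ltW t0)//; congr (_ `^ _).
  by rewrite mulrDr mulr1 divff ?pnatr_eq0 -?lt0n// natr1.
have tt : r / k.+1%:R <= r * t.
  by rewrite ler_pM2l// lef_pV2 ?posrE ?ltr0n// ler_nat.
rewrite P1; move: (k%:R `^ alpha) (powR_ge0 k%:R alpha) => P P0.
set q := (1 + t) `^ alpha in q2 q2r *.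
have -> : P * q * (P * q * (1 + r / k.+1%:R)) = P ^+ 2 * (q * q * (1 + r / k.+1%:R)).
  by ring.
rewrite exprMn ler_wpM2l ?sqr_ge0// [leRHS]expr2.
rewrite ler_pM//; first by rewrite mulr_ge0 ?powR_ge0.
- by rewrite addr_ge0// divr_ge0// ltW.
- by rewrite lerD2l.
Qed.

(** The ratio (k - 1)^b / k^b = (1 - 1 / k)^b tends to 1 by continuity of
    a |-> a^b at 1. *)
Lemma powR_consecutive_close (R : realType) (b eps : R) : 0 < eps ->
  \forall k \near \oo,
    `|k%:R `^ b - k.-1%:R `^ b| <= eps * k%:R `^ b.
Proof.
move=> eps0.
have cb : {for (1 : R), continuous (fun a : R => a `^ b)}.
  apply: differentiable_continuous; apply/derivable1_diffP.
  by apply: derivable_powR; rewrite in_itv/= ltr01.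
have h1 : (fun n => 1 - harmonic n) @ \oo --> (1 : R).
  rewrite -[X in _ --> X]subr0; apply: cvgB; first exact: cvg_cst.
  exact: cvg_harmonic.
have h2 : (fun n => (1 - harmonic n) `^ b) @ \oo --> (1 : R).
  have one : 1 `^ b = 1 :> R by rewrite powR1.
  by rewrite -[X in _ --> X]one; exact: (continuous_cvg _ cb h1).
have [N _ hN] := (cvgrPdist_le _ _).1 h2 _ eps0.
exists N.+1 => // -[//|k] /= Nk.
have := hN k Nk; rewrite /= => hk.
have kE : k%:R = k.+1%:R * (1 - harmonic k) :> R.
  by rewrite mulrBr mulr1 /harmonic /= divff ?pnatr_eq0// -natr1 addrK.
have hh : 0 <= 1 - harmonic k :> R.
  by rewrite subr_ge0 /harmonic /= invf_le1 ?ltr0n// ler1n.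
rewrite {1}kE powRM// -{1}[_.+1%:R `^ b]mulr1 -mulrBr normrM [leLHS]mulrC.
by rewrite [`|_ `^ _|]ger0_norm ?powR_ge0// ler_wpM2r ?powR_ge0.
Qed.

(** * Decrease of the Lyapunov function *)

Lemma lyapunov_vector (R : realType) (d : nat) (A B B' : R)
    (x y p : 'rV[R]_d) :
  (A + (B - B')) *: (y - x) + B' *: (y - p)
    = (A + B) *: (y - x) + B' *: (x - p).
Proof. by apply/rowP => i; rewrite !mxE; ring. Qed.

(** The coefficients of the extrapolation step are those for which x' cancels on
    the left. *)
Lemma momentum_vector (R : realType) (d : nat) (A B w : R)
    (x x' y z p : 'rV[R]_d) : w != 0 ->
  y = x' + (A / w) *: (x' - x) + ((A + B) / w) *: (z - x') ->
  w *: (y - x') + B *: (x' - p) = A *: (z - x) + B *: (z - p).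
Proof. by move=> w0 ->; apply/rowP => i; rewrite !mxE; field. Qed.

Lemma lyapunovE (R : realType) (d : nat) (f g : 'rV[R]_d -> R)
    (s alpha r : R) (p : 'rV[R]_d) (x y : nat -> 'rV[R]_d) (k : nat) :
  lyapunov f g s alpha r p x y k
    = s * k%:R `^ alpha * kweight alpha r k * (f (x k) + g (x k) - (f p + g p))
      + 2^-1 * enorm (kweight alpha r k *: (y k - x k)
                      + (r * k.-1%:R `^ (alpha - 1)) *: (x k - p)) ^+ 2.
Proof. by rewrite /lyapunov [r * (_ - _)]mulrBr lyapunov_vector. Qed.

Lemma kweight_gt0 (R : realType) (alpha r : R) (k : nat) :
  0 < r -> (0 < k)%N -> 0 < kweight alpha r k.
Proof.
by move=> r0 k0; rewrite addr_gt0 ?mulr_gt0 ?powR_gt0 ?ltr0n.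
Qed.

(** The threshold on k depends on the weights, s and mu only, so it comes before
    the quantification over the starting point and the run. *)
Lemma lyapunov_eventually_decreasing (R : realType) (d : nat) (mu L s alpha r : R)
    (f g : 'rV[R]_d -> R) (xstar : 'rV[R]_d) :
  0 < mu -> mu <= L -> S1 mu L f -> F0 g ->
  argmin (fun x => f x + g x) xstar ->
  0 < s -> s <= 1 / L -> 0 < alpha -> 2 * alpha < r ->
  \forall k \near \oo, forall x0 x y z, mfista f g s alpha r x0 x y z ->
    lyapunov f g s alpha r xstar x y k.+1 <= lyapunov f g s alpha r xstar x y k.
Proof.
move=> mu0 muL fS gF xmin s0 sL a0 ra.
have r0 : 0 < r by lra.
(* The largest relative drift of B that drift_absorbed tolerates. *)
pose eps := Num.min 1 (s * mu / 10).
have eps0 : 0 < eps by rewrite lt_min ltr01 divr_gt0// mulr_gt0.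
have eps1 : eps <= 1 by rewrite ge_min lexx.
have epsc : 10 * eps <= s * mu.
  by rewrite mulrC -ler_pdivlMr// ge_min lexx orbT.
near=> k => x0 x y z [_ _ rec].
have k0 : (0 < k)%N by near: k; exact: nbhs_infty_gt.
have rk : r <= k%:R by near: k; exact: nbhs_infty_ger.
have ck : 2 * alpha * r / (r - 2 * alpha) <= k%:R.
  by near: k; exact: nbhs_infty_ger.
have [/= zE xE yE] := rec k.+1 (ltn0Sn k).
have k1 : (k.+1 == 1)%N = false by rewrite eqSS gtn_eqF.
rewrite k1 in yE.
rewrite !lyapunovE /=.
rewrite (momentum_vector _ _ _ _ _ (x k) _ _ (z k) _ _ yE); last first.
  by rewrite gt_eqF// kweight_gt0.
have B0 : 0 < r * k%:R `^ (alpha - 1) by rewrite mulr_gt0 ?powR_gt0 ?ltr0n.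
have step := proximal_step _ _ mu L s f g xstar mu0 muL fS gF xmin s0 sL (y k).
rewrite -[s * _ * kweight _ _ k.+1]mulrA.
apply: (energy_step _ _ s mu eps _ _ _ _ _
  (f (z k) + g (z k) - (f xstar + g xstar))) => //.
- by rewrite -(mulr_powRB1 (ler0n _ k) a0) ler_wpM2r ?powR_ge0.
- by rewrite mulr_ge0 ?powR_ge0// ltW.
- rewrite -mulrBr normrM (gtr0_norm r0) mulrCA ler_pM2l//.
  by near: k; exact: powR_consecutive_close.
- exact: sqr_weight_growth.
- by rewrite subr_ge0; exact: xmin.
(* The monotone choice of x_(k+1) never exceeds the value at z_k. *)
- rewrite lerD2r xE; case: ifP => // /negbT.
  by rewrite -ltNge => /ltW.
- by have := step (x k) _ zE; lra.
- by have := step xstar _ zE; lra.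
Unshelve. all: by end_near. Qed.

Theorem theorem4p2 (R : realType) (d : nat) (mu L : R)
    (mu_gt0 : 0 < mu) (mu_le_L : mu <= L)
    (f g : 'rV[R]_d -> R) (fS : S1 mu L f) (gF : F0 g)
    (xstar : 'rV[R]_d) (xstar_min : argmin (fun x => f x + g x) xstar)
    (s : R) (s_gt0 : 0 < s) (s_le : s <= 1 / L)
    (alpha : R) (alpha_gt0 : 0 < alpha) (r : R) (r_gt : 2 * alpha < r) :
  exists K : nat, [/\ (0 < K)%N, alpha < 1 -> (2 <= K)%N
    & forall (x0 : 'rV[R]_d) (x y z : nat -> 'rV[R]_d),
        mfista f g s alpha r x0 x y z ->
        (forall k : nat, (K <= k)%N ->
           (f (x k) + g (x k)) - (f xstar + g xstar)
             <= lyapunov f g s alpha r xstar x y K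
                / (s * k%:R `^ alpha
                   * (k%:R `^ alpha + r * k%:R `^ (alpha - 1))))
        /\
        (s = 1 / L ->
         forall k : nat, (K <= k)%N ->
           (f (x k) + g (x k)) - (f xstar + g xstar)
             <= L * lyapunov f g s alpha r xstar x y K
                / (k%:R `^ alpha
                   * (k%:R `^ alpha + r * k%:R `^ (alpha - 1))))].
Proof.
have r0 : 0 < r by lra.
have L0 : 0 < L by exact: lt_le_trans mu_le_L.
have [N _ dec] := lyapunov_eventually_decreasing _ _ mu L s alpha r f g xstar
  mu_gt0 mu_le_L fS gF xstar_min s_gt0 s_le alpha_gt0 r_gt.
exists (maxn 2 N); split=> [||x0 x y z run].
- by rewrite (leq_trans _ (leq_maxl 2 N)).
- by move=> _; exact: leq_maxl.
set E := lyapunov f g s alpha r xstar x y; set K := maxn 2 N.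
have mono k : (K <= k)%N -> E k <= E K.
  elim: k => [|k IH]; first by rewrite leqn0 => /eqP ->.
  rewrite leq_eqVlt => /orP[/eqP <- //|]; rewrite ltnS => Kk.
  apply: le_trans (IH Kk); apply: dec run.
  by rewrite /= (leq_trans (leq_maxr 2 N)).
have bound k : (K <= k)%N ->
    f (x k) + g (x k) - (f xstar + g xstar)
      <= E K / (s * k%:R `^ alpha * kweight alpha r k).
  move=> Kk; have k0 : (0 < k)%N.
    by apply: leq_trans Kk; rewrite (leq_trans _ (leq_maxl 2 N)).
  rewrite ler_pdivlMr; last first.
    by rewrite !mulr_gt0 ?powR_gt0 ?ltr0n ?kweight_gt0.
  apply: le_trans (mono k Kk).
  rewrite /E lyapunovE mulrC lerDl mulr_ge0 ?sqr_ge0//.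
split=> [k /bound //|sE k /bound].
rewrite /kweight; congr (_ <= _).
by rewrite sE div1r -mulrA invfM invrK mulrA [E K * L]mulrC.
Qed.
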